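(* Let $n$ agents communicate over an undirected connected graph with adjacency matrix $A=[a_{ij}]\in\{0,1\}^{n\times n}$ ($a_{ij}=a_{ji}$, $a_{ii}=0$). Each agent $i$ has a time-varying reference signal $r_i:[0,\infty)\to\mathbb{R}^m$ with $\dot r_i(t)=f_i(t)$, and a state $x_i(t)\in\mathbb{R}^m$ updated by $$\dot x_i(t)=f_i(t)+\kappa\sum_{j=1}^n a_{ij}\big(x_j(t)-x_i(t)\big),\qquad x_i(0)=r_i(0),$$ where $\kappa>0$ is a constant. Fix an agent $i$ and consider the following observer, run by an external eavesdropper who knows $A$, $\kappa$ and the trajectories $x_j(t)$ of all agents $j$: $$\begin{aligned} \dot{\hat x}_i(t)&=\hat f_i(t)+\kappa\sum_{j=1}^n a_{ij}\big(x_j(t)-x_i(t)\big)+k_1\tilde x_i(t),\\ \dot{\hat r}_i(t)&=k_2\big(x_i(t)-z_i(t)-\hat r_i(t)\big)+\hat f_i(t),\\ \hat f_i(t)&=k_3x_i(t)+\hat f_i'(t),\\ \dot{\hat f}_i'(t)&=-k_3\Big(\hat f_i(t)+\kappa\sum_{j=1}^n a_{ij}\big(x_j(t)-x_i(t)\big)\Big)+k_4\tilde x_i(t), \end{aligned}$$ where $\tilde x_i(t)=x_i(t)-\hat x_i(t)$, $k_1,k_2,k_3,k_4$ are positive constants, and $z_i$ is the filter $\dot z_i(t)=\kappa\sum_{j=1}^n a_{ij}(x_j(t)-x_i(t))$, $z_i(0)=0$ (initial values of $\hat x_i,\hat r_i,\hat f_i'$ arbitrary). Assume $r_i$, $f_i$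 and $\dot f_i$ are bounded on $[0,\infty)$. Then the positive constants $k_1,\dots,k_4$ can be designed so that: (1) the estimation errors $\tilde r_i(t)=r_i(t)-\hat r_i(t)$ and $\tilde f_i(t)=f_i(t)-\hat f_i(t)$ are uniformly ultimately bounded; and (2) if in addition $\dot f_i\in\mathcal{L}_2$, then $\tilde r_i(t)\to0$ and $\tilde f_i(t)\to0$ as $t\to\infty$.
   Context: Uniformly ultimately bounded is in the standard sense of nonlinear systems theory (Khalil): there is a bound $b$ such that for every initial condition there is a time $T$ after which the error norm stays below $b$. $\mathcal{L}_2$ denotes square-integrable functions on $[0,\infty)$. *)

(* Defs.v *)
From HB Require Import structures.
From mathcomp Require Import all_boot all_order all_algebra.
From mathcomp Require Import all_classical all_reals all_analysis.
Set Implicit Arguments. Unset Strict Implicit. Unset Printing Implicit Defensive.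
Import Order.TTheory GRing.Theory Num.Theory.
Import numFieldNormedType.Exports.
Local Open Scope classical_set_scope.
Local Open Scope ring_scope.

Definition adjacency_matrix (R : realType) (n : nat) (A : 'M[R]_n) : Prop :=
  (forall j l, A j l = 0 \/ A j l = 1) /\
  (forall j l, A j l = A l j) /\
  (forall j, A j j = 0).

Definition graph_connected (R : realType) (n : nat) (A : 'M[R]_n) : Prop :=
  forall j l : 'I_n, connect (fun p q : 'I_n => A p q != 0) j l.

Definition coupling (R : realType) (n m : nat) (kappa : R) (A : 'M[R]_n)
  (x : 'I_n -> R -> 'rV[R]_m) (i : 'I_n) (t : R) : 'rV[R]_m :=
  kappa *: \sum_(j < n) A i j *: (x j t - x i t).

Definition fhat (R : realType) (n m : nat) (x : 'I_n -> R -> 'rV[R]_m)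
  (i : 'I_n) (k3 : R) (fp : R -> 'rV[R]_m) (t : R) : 'rV[R]_m :=
  k3 *: x i t + fp t.

Definition observer (R : realType) (n m : nat) (kappa : R) (A : 'M[R]_n)
  (x : 'I_n -> R -> 'rV[R]_m) (i : 'I_n) (k1 k2 k3 k4 : R)
  (xh rh fp z : R -> 'rV[R]_m) : Prop :=
  z 0 = 0 /\
  (forall t : R, 0 <= t -> is_derive t 1 z (coupling kappa A x i t)) /\
  (forall t : R, 0 <= t -> is_derive t 1 xh
     (fhat x i k3 fp t + coupling kappa A x i t + k1 *: (x i t - xh t))) /\
  (forall t : R, 0 <= t -> is_derive t 1 rh
     (k2 *: (x i t - z t - rh t) + fhat x i k3 fp t)) /\
  (forall t : R, 0 <= t -> is_derive t 1 fp
     (- k3 *: (fhat x i k3 fp t + coupling kappa A x i t)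
      + k4 *: (x i t - xh t))).

Definition L2_vec (R : realType) (m : nat) (g : R -> 'rV[R]_m) : Prop :=
  (forall k : 'I_m, measurable_fun [set t : R | 0 <= t] (fun t => g t 0 k)) /\
  (\int[lebesgue_measure]_(t in [set t : R | (0 <= t)%R]) ((`|g t| ^+ 2)%R)%:E
     < +oo)%E.

(* Main.v *)
(** All four gains are taken equal to 1. The filter output [x i - z] equals [r i],
so in each coordinate the errors [p = r - rh], [e = f - fhat], [y = x - xh] obey
[p' = e - p], [e' = df - e - y], [y' = e - y], and [V = p^2 + e^2 + y^2] satisfies
[V' <= - V / 2 + 2 df^2]. For bounded [df], Gronwall gives the ultimate bound. For
[df] in L2, integrating [(exp (t / 2) V)'] from [a] to [b] gives
[V b <= exp (- (b - a) / 2) V a + 2 int_a^b df^2], and the tails of the integral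
vanish. Since [df] is only measurable, this integration uses the fundamental theorem
of calculus for bounded, possibly discontinuous, derivatives. *)

Require Import Defs.
From HB Require Import structures.
From mathcomp Require Import all_boot all_order all_algebra.
From mathcomp Require Import all_classical all_reals all_analysis.
From mathcomp Require Import measurable_realfun ring lra.
Import Order.TTheory GRing.Theory Num.Theory.
Import numFieldNormedType.Exports.
Local Open Scope classical_set_scope.
Local Open Scope ring_scope.

(** * Calculus: primitives and the integral of a bounded derivative *)

(** The derivative is read along the steps 1 / (n + 1), because dominated convergence works with
    sequences of functions. *)
Lemma is_derive_cvg_harmonic (R : realType) (F : R -> R) (x l : R) :
  is_derive x 1 F l ->
  n.+1%:R * (F (x + n.+1%:R^-1) - F x) @[n --> \oo] --> l.
Proof.
move=> dF.
have dl : h^-1 *: (F (h *: 1 + x) - F x) @[h --> 0^'] --> l.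
  by rewrite -(derive_val (is_derive := dF)); exact: (ex_derive (is_derive := dF)).
have c0 : n.+1%:R^-1 @[n --> \oo] --> (0 : R)^'.
  move=> B; rewrite /dnbhs /within nbhs_simpl /= => hB.
  have := @cvg_harmonic R _ hB; rewrite nbhs_simpl /=; apply: filterS => k /=.
  by apply; rewrite invr_eq0 pnatr_eq0.
have := cvg_comp _ _ c0 dl.
apply: cvg_trans; apply: near_eq_cvg; apply: nearW => n /=.
by rewrite invrK /GRing.scale /= mulr1 (addrC x).
Qed.

(** Freezing [F] at the value [F a] to the left of [a] makes it continuous on the whole line, so
    that it has a primitive around [a]. *)
Lemma continuous_clamp (R : realType) (F : R -> R) (a : R) :
  (forall t, a <= t -> {for t, continuous F}) ->
  continuous (fun t => F (Num.max a t)).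
Proof.
move=> cF t.
apply: (@continuous_comp _ _ _ (fun t => Num.max a t) F).
  by apply: (@continuous_max R R (cst a) id t); [exact: cvg_cst|exact: cvg_id].
by apply: cF; rewrite le_max lexx.
Qed.

Lemma is_derive1_continuous (R : realType) (F : R -> R) (x l : R) :
  is_derive x 1 F l -> {for x, continuous F}.
Proof.
move=> dF; apply: differentiable_continuous; apply/derivable1_diffP.
exact: (ex_derive (is_derive := dF)).
Qed.

(** The primitive is the integral from [a]. It vanishes to the left of [a], so its derivative is
    claimed only for [a < t]. *)
Lemma continuous_primitive (R : realType) (F : R -> R) (a : R) :
  continuous F -> exists P : R -> R, forall t, a < t -> is_derive t 1 P (F t).
Proof.
move=> cF.
exists (fun t => (\int[lebesgue_measure]_(x in `[a, t]) F x)%R) => t at'.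
have iF : lebesgue_measure.-integrable `[a, t + 1] (EFin \o F).
  apply: continuous_compact_integrable; first exact: segment_compact.
  exact: continuous_subspaceT.
have tt : t < t + 1 by rewrite ltrDl.
have [d1 d2] := continuous_FTC1_closed tt iF at' (cF t).
by split => //; rewrite -derive1E.
Qed.

(* The difference quotients of step [1 / n] converge to [F'] and are bounded by [K],
   so their integrals converge by dominated convergence; as they are continuous,
   these integrals are difference quotients of a primitive [P] of [F]. *)
Theorem integral_bounded_derivative (R : realType) (F F' : R -> R) (a b K : R) :
  a < b -> (forall t, a <= t -> is_derive t 1 F (F' t)) ->
  (forall t, a <= t <= b + 1 -> `|F' t| <= K) ->
  lebesgue_measure.-integrable `[a, b] (EFin \o F') /\
  \int[lebesgue_measure]_(t in `[a, b]) F' t = F b - F a.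
Proof.
move=> ab dF F'K.
pose G t := F (Num.max a t).
have GF t : a <= t -> G t = F t by move=> at'; rewrite /G max_r.
have cG : continuous G.
  by apply: continuous_clamp => t at'; exact: is_derive1_continuous (dF _ at').
(* Starting the primitive at [a - 1] makes [a] itself an interior point. *)
have [P dP] := @continuous_primitive R G (a - 1) cG.
have lea1 t : a <= t -> a - 1 < t by lra.
pose h n : R := n.+1%:R^-1.
have h0 n : 0 < h n by rewrite invr_gt0.
have h1 n : h n <= 1 by rewrite invf_le1 ?ler1n.
pose q n t := n.+1%:R * (G (t + h n) - G t).
pose Q n t := n.+1%:R * (P (t + h n) - P t).
have cq n : continuous (q n).
  move=> t; apply: cvgM; first exact: cvg_cst.
  apply: cvgB; last exact: cG.
  apply: (@continuous_comp _ _ _ (fun t => t + h n) G); last exact: cG.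
  by apply: cvgD; [exact: cvg_id|exact: cvg_cst].
have dQ n t : a <= t -> is_derive t 1 (Q n) (q n t).
  move=> at'.
  have d1 := dP _ (lea1 _ at').
  have d2 : is_derive (t + h n) 1 P (G (t + h n)).
    by apply: dP; apply: lea1; rewrite (le_trans at')// lerDl ltW.
  have d3 : is_derive t 1 (P \o shift (h n)) (G (t + h n) * 1).
    exact: (@is_derive1_comp R P (shift (h n)) t _ _ d2 (is_derive_shift _ _ _)).
  rewrite (_ : Q n = n.+1%:R \*: ((P \o shift (h n)) - P)) //.
  rewrite /q -[G (t + h n)]mulr1.
  exact: is_deriveZ.
have intq n : (\int[lebesgue_measure]_(t in `[a, b]) (q n t)%:E
               = (Q n b - Q n a)%:E)%E.
  rewrite (@continuous_FTC2 _ (q n) (Q n)) //.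
  - exact: continuous_subspaceT.
  - split.
    + move=> t /[!in_itv]/= /andP[at' _].
      exact: (ex_derive (is_derive := dQ n t (ltW at'))).
    + by apply: cvg_at_right_filter; apply: is_derive1_continuous (dQ n a _).
    + apply: cvg_at_left_filter.
      by apply: is_derive1_continuous (dQ n b (ltW ab)).
  - move=> t /[!in_itv]/= /andP[at' _].
    by rewrite derive1E (derive_val (is_derive := dQ n t (ltW at'))).
have cvgQ t : a <= t -> Q n t @[n --> \oo] --> F t.
  by move=> at'; rewrite -GF//; exact: is_derive_cvg_harmonic (dP _ (lea1 _ at')).
have cvgq t : a <= t -> q n t @[n --> \oo] --> F' t.
  move=> at'.
  have := is_derive_cvg_harmonic _ _ _ _ (dF _ at').
  apply: cvg_trans; apply: near_eq_cvg; apply: nearW => n /=.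
  rewrite /q !GF// (le_trans at')// lerDl ltW//.
(* By the mean value theorem the quotient equals [F'] at some point between [t] and [t + h n]. That
   point is at most [b + 1] since [h n <= 1], which explains the range of the bound [K]. *)
have qK n t : a <= t -> t <= b -> `|q n t| <= K.
  move=> at' tb.
  have tth : t < t + h n by rewrite ltrDl.
  have dFt : forall x, x \in `]t, t + h n[%R -> is_derive x 1 F (F' x).
    by move=> x; rewrite in_itv/= => /andP[tx _]; apply: dF; lra.
  have cFt : {within `[t, t + h n], continuous F}.
    apply: continuous_in_subspaceT => x; rewrite inE/= in_itv/= => /andP[tx _].
    by apply: is_derive1_continuous (dF x _); lra.
  have [c cI cE] := MVT tth dFt cFt.
  move: cI; rewrite in_itv/= => /andP[c1 c2].
  rewrite /q !GF//; last by rewrite (le_trans at')// ltW.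
  rewrite cE addrAC subrr add0r mulrCA divff ?mulr1//.
  by apply: F'K; have := h1 n; lra.
have mq n : measurable_fun `[a, b] (q n).
  apply: measurable_funTS; exact: continuous_measurable_fun.
(* [F'] is measurable as a pointwise limit of the continuous quotients [q n]. *)
have mF' : measurable_fun `[a, b] F'.
  apply: (measurable_fun_cvg mq) => t /=; rewrite in_itv/= => /andP[at' _].
  exact: cvgq.
have iK : lebesgue_measure.-integrable `[a, b] (EFin \o cst K).
  apply: continuous_compact_integrable; first exact: segment_compact.
  by apply: continuous_subspaceT => ?; exact: cvg_cst.
have mI : measurable (`[a, b] : set R) by [].
have mqE n : measurable_fun `[a, b] (fun t => (q n t)%:E).
  exact/measurable_EFinP.
have mFE : measurable_fun `[a, b] (EFin \o F') by exact/measurable_EFinP.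
have cvgqE : {ae lebesgue_measure, forall t : R, `[a, b]%classic t ->
    (q n t)%:E @[n --> \oo] --> (EFin \o F') t}.
  apply: aeW => t /=; rewrite in_itv/= => /andP[at' _].
  by apply: cvg_EFin; [exact: nearW|exact: cvgq].
have qKE : {ae lebesgue_measure, forall (t : R) n, `[a, b]%classic t ->
    (`|(q n t)%:E| <= (EFin \o cst K) t)%E}.
  apply: aeW => t n /=; rewrite in_itv/= => /andP[at' tb].
  by rewrite lee_fin; exact: qK.
have [iF' _ cvgI] := @dominated_convergence _ _ R lebesgue_measure _ mI _ _ _ mqE mFE cvgqE iK qKE.
split=> //; rewrite /Rintegral.
rewrite (_ : integral _ _ _ = (F b - F a)%:E)//.
apply: (@cvg_unique _ (@ereal_hausdorff R) _ _ _ _ cvgI).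
rewrite (_ : (fun n => _) = (fun n => (Q n b - Q n a)%:E)); last first.
  by apply/funext => n; rewrite intq.
apply: cvg_EFin; first exact: nearW.
by apply: cvgB; apply: cvgQ; rewrite // ltW.
Qed.

(** * Gronwall estimates with constant and with integrable forcing *)

Lemma is_derive_expR_scale (R : realType) (V : R -> R) (c t dV : R) :
  is_derive t 1 V dV ->
  is_derive t 1 (fun s => expR (c * s) * V s) (expR (c * t) * (c * V t + dV)).
Proof.
move=> dVt.
have d1 : is_derive t 1 (fun s => expR (c * s)) (expR (c * t) * c).
  apply: (@is_derive1_comp R expR (fun s => c * s)).
  by have := @is_deriveZ R R R id c t 1 1 (is_derive_id _ _); rewrite /GRing.scale/= mulr1.
have := @is_deriveM R R _ V t 1 _ _ d1 dVt.
rewrite /GRing.scale/= => /is_derive_eq; apply.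
ring.
Qed.

(** The function [W s = expR (c * s) * (V s - k)] has nonpositive derivative, hence [W t <= W 0] by
    the mean value theorem. *)
Lemma gronwall_constant (R : realType) (V V' : R -> R) (c k : R) :
  0 < c ->
  (forall t : R, 0 <= t -> is_derive t 1 V (V' t)) ->
  (forall t : R, 0 <= t -> V' t <= - (c * V t) + c * k) ->
  forall t : R, 0 <= t -> V t <= expR (- (c * t)) * (V 0 - k) + k.
Proof.
move=> c0 dV V'le t t0.
pose W s := expR (c * s) * (V s - k).
have dW (s : R) : 0 <= s -> is_derive s 1 W (expR (c * s) * (c * (V s - k) + V' s)).
  move=> s0; apply: is_derive_expR_scale.
  rewrite -[V' s]subr0.
  exact: (@is_deriveB R R R V (cst k) s 1 _ _ (dV _ s0) (is_derive_cst _ _ _)).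
have cW : {within `[0, t], continuous W}.
  apply: continuous_in_subspaceT => s; rewrite inE/= in_itv/= => /andP[s0 _].
  exact: is_derive1_continuous (dW _ s0).
have W'le (s : R) : s \in `]0, t[%R -> is_derive s 1 W (expR (c * s) * (c * (V s - k) + V' s)).
  by rewrite in_itv/= => /andP[s0 _]; apply: dW; exact: ltW.
have [s sI WE] := MVT_segment t0 W'le cW.
move: sI; rewrite in_itv/= => /andP[s0 _].
have Wt : W t <= W 0.
  rewrite -subr_le0 WE subr0 mulr_le0_ge0//.
  rewrite pmulr_rle0 ?expR_gt0//.
  by have := V'le s s0; lra.
move: Wt; rewrite /W mulr0 expR0 mul1r => Wt.
rewrite -lerBlDr -(ler_pM2l (expR_gt0 (c * t))) mulrA -expRD subrr expR0 mul1r.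
exact: Wt.
Qed.

(** The partial integrals [G b] from 0 to [b] are nondecreasing and bounded by the full integral, so
    they converge to their supremum. The integral over [[a, b]] is [G b - G a], at most the supremum
    minus [G a]. *)
Lemma integrable_tail (R : realType) (h : R -> R) :
  lebesgue_measure.-integrable `[0, +oo[ (EFin \o h) -> (forall t, 0 <= h t) ->
  forall e, 0 < e -> exists2 a, 0 <= a &
    forall b, a < b -> \int[lebesgue_measure]_(t in `[a, b]) h t <= e.
Proof.
move=> ih h0 e e0.
have ihS (a b : itv_bound R) : (BLeft 0 <= a)%O ->
    lebesgue_measure.-integrable [set` Interval a b] (EFin \o h).
  move=> a0; apply: integrableS ih => //.
  apply: (@subset_trans _ [set` Interval a +oo%O]).
    by apply: subset_itvl; exact: lex1.
  exact: subset_itvr.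
pose G b := \int[lebesgue_measure]_(t in `[0, b]) h t.
have GD a b : 0 <= a -> a < b -> \int[lebesgue_measure]_(t in `[a, b]) h t = G b - G a.
  move=> a0 ab.
  rewrite /G Rintegral_itvB; [|exact: ihS|by []|by rewrite bnd_simp ltW].
  by rewrite Rintegral_itv_obnd_cbnd//; exact: ihS.
have ndG : nondecreasing_fun G.
  move=> a b; rewrite le_eqVlt => /predU1P[->//|ab].
  have [a0|a0] := leP 0 a.
    by rewrite -subr_ge0 -GD//; exact: Rintegral_ge0.
  by rewrite {1}/G set_itv_ge ?Rintegral_set0 ?bnd_simp -?ltNge//; exact: Rintegral_ge0.
have ubG : has_ubound (range G).
  exists (\int[lebesgue_measure]_(t in `[0, +oo[) h t) => _ [b _ <-].
  rewrite /G /Rintegral fine_le//.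
  - by apply: (@integrable_fin_num _ _ R lebesgue_measure) => //; exact: ihS.
  - exact: (@integrable_fin_num _ _ R lebesgue_measure).
  - apply: ge0_subset_integral => //.
    + exact: (measurable_int lebesgue_measure).
    + by move=> t _; rewrite lee_fin.
    + by apply: subset_itvl.
have cG := nondecreasing_cvgr ndG ubG.
have /cvgrPdist_le/(_ _ e0) [a [_ aP]] := cG.
(* The estimate holds strictly beyond [a], hence the shift by 1; the maximum keeps the point
   nonnegative. *)
exists (Num.max 0 (a + 1)); first by rewrite le_max lexx.
move=> b ab.
have ma0 : 0 <= Num.max 0 (a + 1) by rewrite le_max lexx.
have ma1 : a < Num.max 0 (a + 1).
  by apply: (@lt_le_trans _ _ (a + 1)); [lra|rewrite le_max lexx orbT].
rewrite GD//.
have := aP _ ma1 => /=; rewrite ler_distl => /andP[_].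
have : G b <= sup (range G) by apply: ub_le_sup => //; exists b.
lra.
Qed.

(** The bounds [B] and [K] keep the derivative of [expR (c * t) * V t] bounded on bounded intervals,
    so that it can be integrated without being continuous. [B] also bounds [V a] at the starting
    point. *)
Lemma gronwall_integrable (R : realType) (V V' h : R -> R) (c B K : R) :
  0 < c ->
  (forall t : R, 0 <= t -> is_derive t 1 V (V' t)) ->
  (forall t : R, 0 <= t -> V' t <= - (c * V t) + h t) ->
  (forall t : R, 0 <= t -> 0 <= V t <= B) ->
  (forall t : R, 0 <= t -> `|V' t| <= K) ->
  (forall t : R, 0 <= h t) ->
  lebesgue_measure.-integrable `[0, +oo[ (EFin \o h) ->
  V t @[t --> +oo] --> 0.
Proof.
move=> c0 dV V'le VB V'K h0 ih.
have step a b : 0 <= a -> a < b ->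
    V b <= expR (- (c * (b - a))) * B + \int[lebesgue_measure]_(t in `[a, b]) h t.
  move=> a0 ab.
  pose F t := expR (c * t) * V t.
  pose F' t := expR (c * t) * (c * V t + V' t).
  have dF (t : R) : a <= t -> is_derive t 1 F (F' t).
    by move=> at'; apply: is_derive_expR_scale; apply: dV; lra.
  have F'K t : a <= t <= b + 1 -> `|F' t| <= expR (c * (b + 1)) * (c * B + K).
    move=> /andP[at' tb]; rewrite normrM ger0_norm ?expR_ge0//.
    have t0 : 0 <= t by lra.
    apply: ler_pM; rewrite ?expR_ge0//; first by rewrite ler_expR ler_pM2l.
    apply: (le_trans (ler_normD _ _)); apply: lerD; last exact: V'K.
    have /andP[V0 VB'] := VB _ t0.
    by rewrite ger0_norm ?mulr_ge0// ?(ltW c0)// ler_pM2l.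
  have [iF' FE] := integral_bounded_derivative R F F' a b _ ab dF F'K.
  have ihab : lebesgue_measure.-integrable `[a, b] (EFin \o h).
    apply: integrableS ih => //; apply: subset_itv; rewrite bnd_simp//.
  have iexph : lebesgue_measure.-integrable `[a, b]
      (EFin \o (fun t => expR (c * b) * h t)).
    by have := integrableZl _ (expR (c * b)) ihab; apply.
  (* On [[a, b]] the weight [expR (c * t)] is at most [expR (c * b)], which leaves the integral and
     is later cancelled. *)
  have : F b - F a <= expR (c * b) * \int[lebesgue_measure]_(t in `[a, b]) h t.
    rewrite -FE -RintegralZl//; apply: le_Rintegral => // t.
    rewrite /= in_itv/= => /andP[at' tb].
    have t0 : 0 <= t by lra.
    apply: (@le_trans _ _ (expR (c * t) * h t)).
      by rewrite /F' ler_pM2l ?expR_gt0//; have := V'le _ t0; lra.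
    by rewrite ler_wpM2r// ler_expR ler_pM2l.
  rewrite /F => Fle.
  rewrite -(ler_pM2l (expR_gt0 (c * b))) mulrDr mulrA -expRD.
  have -> : c * b + - (c * (b - a)) = c * a by ring.
  have /andP[_ VaB] := VB _ a0.
  have : expR (c * a) * V a <= expR (c * a) * B by rewrite ler_pM2l ?expR_gt0.
  lra.
have B0 : 0 <= B by have /andP[] := VB 0 (lexx _); exact: le_trans.
apply/cvgrPdist_le => e e0.
(* One half of [e] pays for the tail of the integral, which fixes [a]; the other half pays for the
   decaying exponential as [t] grows. *)
have e20 : 0 < e / 2 by lra.
have [a a0 aP] := integrable_tail R h ih h0 (e / 2) e20.
have cexp : expR (- (c * (t - a))) * B @[t --> +oo] --> 0.
  rewrite -[X in _ --> X](mul0r B); apply: cvgMl.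
  apply: (@cvg_comp _ _ _ (fun t => c * (t - a)) (fun u => expR (- u))
    _ _ _ _ (@cvgr_expR R)).
  apply/cvgryPge => A; near=> t.
  by rewrite -ler_pdivrMl// lerBrDr; near: t; apply: nbhs_pinfty_ge; exact: num_real.
have /cvgrPdist_le/(_ _ e20) cexpe := cexp.
near=> t.
have ta : a < t by near: t; apply: nbhs_pinfty_gt; exact: num_real.
have /andP[Vt0 _] := VB t (ltW (le_lt_trans a0 ta)).
rewrite sub0r normrN ger0_norm//.
have : `|0 - expR (- (c * (t - a))) * B| <= e / 2 by near: t.
rewrite sub0r normrN ger0_norm ?mulr_ge0 ?expR_ge0// => h1.
have := step _ _ a0 ta; have := aP _ ta; lra.
Unshelve. all: by end_near. Qed.

(** * The scalar error system and its Lyapunov function *)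

Section error_dynamics.
Variables (R : realType) (p e y g : R -> R) (M : R).
Hypothesis dp : forall t : R, 0 <= t -> is_derive t 1 p (e t - p t).
Hypothesis de : forall t : R, 0 <= t -> is_derive t 1 e (g t - e t - y t).
Hypothesis dy : forall t : R, 0 <= t -> is_derive t 1 y (e t - y t).
Hypothesis gM : forall t : R, 0 <= t -> `|g t| <= M.

Let V (t : R) := p t ^+ 2 + e t ^+ 2 + y t ^+ 2.
Let V' (t : R) := 2 * p t * (e t - p t) + 2 * e t * (g t - e t - y t)
  + 2 * y t * (e t - y t).

Let dV (t : R) : 0 <= t -> is_derive t 1 V (V' t).
Proof.
move=> t0.
have dX (u : R -> R) (du : R) : is_derive t 1 u du ->
    is_derive t 1 (fun s => u s ^+ 2) (2 * u t * du).
  by move=> h; have := @is_deriveX R R u 2 t 1 du h; rewrite expr1; exact: id.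
exact: is_deriveD (is_deriveD (dX _ _ (dp _ t0)) (dX _ _ (de _ t0))) (dX _ _ (dy _ t0)).
Qed.

(* The choice k4 = 1 cancels the cross terms in [e] and [y], so no gain has to be large. *)
Let V'le (t : R) : V' t <= - (2^-1 * V t) + 2 * g t ^+ 2.
Proof.
have h1 := sqr_ge0 (p t - e t); have h2 := sqr_ge0 (e t - 2 * g t).
have h3 := sqr_ge0 (y t); have h4 := sqr_ge0 (p t).
rewrite /V' /V; lra.
Qed.

Let g2M (t : R) : 0 <= t -> g t ^+ 2 <= M ^+ 2.
Proof.
move=> t0; have gt := gM _ t0; rewrite -real_normK ?num_real//.
by rewrite ler_pXn2r ?nnegrE//; exact: le_trans gt.
Qed.

(** Gronwall with [c = 1 / 2] and [k = 4 * M ^+ 2], for which [c * k] is the forcing bound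
    [2 * M ^+ 2]. *)
Let V_bound (t : R) : 0 <= t ->
  V t <= expR (- (2^-1 * t)) * (V 0 - 4 * M ^+ 2) + 4 * M ^+ 2.
Proof.
apply: (@gronwall_constant R V V'); [lra|exact: dV|].
by move=> s s0; have := V'le s; have := g2M s s0; lra.
Qed.

Lemma error_ultimate_bound : exists T : R, forall t : R, T <= t ->
  `|p t| <= 2 * `|M| + 1 /\ `|e t| <= 2 * `|M| + 1.
Proof.
have cexp : expR (- (2^-1 * t)) * (V 0 - 4 * M ^+ 2) @[t --> +oo] --> 0.
  rewrite -[X in _ --> X](mul0r (V 0 - 4 * M ^+ 2)); apply: cvgMl.
  apply: (@cvg_comp _ _ _ (fun t => 2^-1 * t) (fun u => expR (- u))
    _ _ _ _ (@cvgr_expR R)).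
  apply/cvgryPge => A; near=> t.
  by rewrite -ler_pdivrMl//; near: t; apply: nbhs_pinfty_ge; exact: num_real.
have /cvgrPdist_le/(_ _ ltr01) [T [_ TP]] := cexp.
exists (Num.max 0 (T + 1)) => t; rewrite ge_max => /andP[t0 Tt].
have Tt' : T < t by lra.
have := TP _ Tt'; rewrite /= sub0r normrN ler_norml => /andP[_ h1].
have h2 := V_bound _ t0.
(* Once the exponential term is at most 1, [V t] is at most [4 * M ^+ 2 + 1]; completing the square
   gives a bound whose root is explicit. *)
have hV : V t <= (2 * `|M| + 1) ^+ 2.
  have -> : (2 * `|M| + 1) ^+ 2 = 4 * `|M| ^+ 2 + 4 * `|M| + 1 by ring.
  by rewrite real_normK ?num_real//; have := normr_ge0 M; lra.
have M0 : 0 <= 2 * `|M| + 1 by have := normr_ge0 M; lra.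
have sq (u : R) : u ^+ 2 <= V t -> `|u| <= 2 * `|M| + 1.
  move=> uV; rewrite -(@ler_pXn2r _ 2) ?nnegrE// real_normK ?num_real//.
  exact: le_trans uV hV.
have := sqr_ge0 (p t); have := sqr_ge0 (e t); have := sqr_ge0 (y t).
by split; apply: sq; rewrite /V; lra.
Unshelve. all: by end_near. Qed.

Lemma error_cvg0 :
  lebesgue_measure.-integrable `[0, +oo[ (EFin \o (fun t => g t ^+ 2)) ->
  p t @[t --> +oo] --> 0 /\ e t @[t --> +oo] --> 0.
Proof.
move=> ig.
have V0 t : 0 <= V t by rewrite !addr_ge0 ?sqr_ge0.
pose B := V 0 + 4 * M ^+ 2.
have VB (t : R) : 0 <= t -> 0 <= V t <= B.
  move=> t0; rewrite V0/=; apply: (le_trans (V_bound _ t0)).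
  have E1 : expR (- (2^-1 * t)) <= 1 by rewrite expR_le1; lra.
  have E0 := expR_ge0 (- (2^-1 * t)).
  have := ler_wpM2r (V0 0) E1; have := mulr_ge0 E0 (sqr_ge0 M).
  rewrite /B; lra.
(* The cross terms in [e] and [y] cancel in [V']. The products [2 p e] and [2 e g] are absorbed by
   sums of squares, leaving at most [4 V + g ^+ 2] in absolute value. *)
have V'K (t : R) : 0 <= t -> `|V' t| <= 4 * B + M ^+ 2.
  move=> t0; have /andP[_ VtB] := VB t t0; have gt := g2M _ t0.
  have h1 := sqr_ge0 (p t - e t); have h2 := sqr_ge0 (p t + e t).
  have h3 := sqr_ge0 (e t - g t); have h4 := sqr_ge0 (e t + g t).
  have h5 := sqr_ge0 (p t); have h6 := sqr_ge0 (e t); have h7 := sqr_ge0 (y t).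
  rewrite /V in VtB; rewrite /V' ler_norml; rewrite !expr2 in VtB gt h1 h2 h3 h4 h5 h6 h7 *.
  by apply/andP; split; lra.
have cV : V t @[t --> +oo] --> 0.
  apply: (@gronwall_integrable R V V' (fun t => 2 * g t ^+ 2) 2^-1 B (4 * B + M ^+ 2)) => //.
  - by move=> t; rewrite mulr_ge0 ?sqr_ge0.
  - by have := integrableZl _ 2 ig; apply.
have sq (u : R -> R) : (forall t, u t ^+ 2 <= V t) -> u t @[t --> +oo] --> 0.
  move=> uV; apply/cvgrPdist_le => d d0.
  have /cvgrPdist_le/(_ _ (exprn_gt0 2 d0)) := cV.
  apply: filterS => t; rewrite !sub0r !normrN ger0_norm// => h.
  rewrite -(@ler_pXn2r _ 2) ?nnegrE ?(ltW d0)// real_normK ?num_real//.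
  exact: le_trans (uV t) h.
split; apply: sq => t; rewrite /V.
  by have := sqr_ge0 (e t); have := sqr_ge0 (y t); lra.
by have := sqr_ge0 (p t); have := sqr_ge0 (y t); lra.
Qed.

End error_dynamics.

(** * Constancy, and coordinatewise calculus for row vectors *)

Lemma constant_of_is_derive0 (R : realType) (F : R -> R) :
  (forall t : R, 0 <= t -> is_derive t 1 F 0) -> forall t : R, 0 <= t -> F t = F 0.
Proof.
move=> dF t t0; apply/eqP; rewrite -subr_eq0; apply/eqP.
have cF : {within `[0, t], continuous F}.
  apply: continuous_in_subspaceT => s; rewrite inE/= in_itv/= => /andP[s0 _].
  exact: is_derive1_continuous (dF _ s0).
have dF' (s : R) : s \in `]0, t[%R -> is_derive s 1 F ((cst 0) s).
  by rewrite in_itv/= => /andP[s0 _]; apply: dF; exact: ltW.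
by have [s _ ->] := MVT_segment t0 dF' cF; rewrite mul0r.
Qed.

Section row_vectors.
Variables (R : realType) (m : nat).
Implicit Types (v : 'rV[R]_m) (u : R -> 'rV[R]_m) (k : 'I_m).

(** The norm of a row vector is the largest absolute value of its entries, so bounds pass between
    vectors and coordinates with the same constant. *)
Lemma coord_norm_le v k : `|v 0 k| <= `|v|.
Proof. by rewrite [leRHS]/Num.Def.normr/= mx_normrE; exact: (le_bigmax _ _ (0, k)). Qed.

Lemma rV_norm_le v b : 0 <= b -> (forall k, `|v 0 k| <= b) -> `|v| <= b.
Proof.
move=> b0 vb; rewrite [leLHS]/Num.Def.normr/= mx_normrE.
by apply: bigmax_le => // -[j k] _ /=; rewrite (ord1 j).
Qed.

Lemma is_derive_coord u (t : R) v k :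
  is_derive t 1 u v -> is_derive t 1 (fun s => u s 0 k) (v 0 k).
Proof.
move=> du.
have dvu : derivable u t 1 := ex_derive (is_derive := du).
have /derivable_mxP/(_ 0 k) dk := dvu.
apply: DeriveDef => //.
by rewrite -(derive_val (is_derive := du)) derive_mx// mxE.
Qed.

Lemma cvg_rV0 u : (forall k, u t 0 k @[t --> +oo] --> 0) ->
  u t @[t --> +oo] --> (0 : 'rV[R]_m).
Proof.
move=> cu; apply/cvgrPdist_le => d d0.
have : \forall t \near +oo, forall k, `|0 - u t 0 k| <= d.
  by apply: filter_forall => k; have /cvgrPdist_le/(_ _ d0) := cu k.
apply: filterS => t h; rewrite sub0r normrN; apply: rV_norm_le (ltW d0) _ => k.
by have := h k; rewrite sub0r normrN.
Qed.

(** The norm is a finite maximum of absolute values; induction on the list of indices reduces to the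
    maximum of two measurable functions. *)
Lemma measurable_rV_norm (D : set R) u :
  (forall k, measurable_fun D (fun t => u t 0 k)) -> measurable_fun D (fun t => `|u t|).
Proof.
move=> mu.
rewrite (_ : (fun t => _) = (fun t => \big[Num.max/0]_ij `|u t ij.1 ij.2|)); last first.
  by apply/funext => t; rewrite [LHS]/Num.Def.normr/= mx_normrE.
elim: (index_enum _) => [|[j k] s ih].
  by under eq_fun do rewrite big_nil; exact: measurable_cst.
rewrite (ord1 j) (_ : (fun t => _) =
    (fun t => `|u t 0 k|) \max (fun t => \big[Num.max/0]_(ij <- s) `|u t ij.1 ij.2|));
  last by apply/funext => t; rewrite big_cons.
apply: measurable_maxr => //.
by apply: measurableT_comp => //; exact: mu.
Qed.

(** Each squared coordinate is dominated by the squared norm, whose integral is finite. *)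
Lemma L2_vec_coord u k : L2_vec u ->
  lebesgue_measure.-integrable `[0, +oo[ (EFin \o (fun t => u t 0 k ^+ 2)).
Proof.
have DE : `[0, +oo[%classic = [set t : R | 0 <= t].
  by apply/seteqP; split => t /=; rewrite in_itv/= andbT.
rewrite DE.
move=> [mu iu]; set D := [set t : R | 0 <= t] in mu iu *.
have mD : measurable D by rewrite /D -DE.
have mX (w : R -> R) : measurable_fun D w -> measurable_fun D (EFin \o (fun t => w t ^+ 2)).
  by move=> mw; apply/measurable_EFinP; exact: measurable_funX.
apply/integrableP; split; first exact: mX.
apply: le_lt_trans iu; apply: ge0_le_integral => //.
- by apply: measurableT_comp => //; exact: mX.
- by apply: mX; exact: measurable_rV_norm.
- move=> t _ /=; rewrite lee_fin normrX.
  by rewrite ler_pXn2r ?nnegrE//; exact: coord_norm_le.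
Qed.

End row_vectors.

(** * Derivation of the error system from the observer *)

Section observer_errors.
Variables (R : realType) (n m : nat) (A : 'M[R]_n) (kappa : R).
Variables (r f x : 'I_n -> R -> 'rV[R]_m) (i : 'I_n) (df : R -> 'rV[R]_m).
Hypothesis dr : forall t : R, 0 <= t -> is_derive t 1 (r i) (f i t).
Hypothesis dx : forall t : R, 0 <= t ->
  is_derive t 1 (x i) (f i t + coupling kappa A x i t).
Hypothesis xr0 : x i 0 = r i 0.
Hypothesis df_f : forall t : R, 0 <= t -> is_derive t 1 (f i) (df t).
Variables xh rh fp z : R -> 'rV[R]_m.
Hypothesis obs : observer kappa A x i 1 1 1 1 xh rh fp z.

Let p t := r i t - rh t.
Let e t := f i t - fhat x i 1 fp t.
Let y t := x i t - xh t.

(* The eavesdropper reconstructs the reference exactly, since [x i - z] and [r i]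
   have the same derivative and the same initial value. *)
Lemma reference_eq (t : R) : 0 <= t -> x i t - z t = r i t.
Proof.
have [z0 [dz _]] := obs.
move=> t0; apply/rowP => k.
pose F s := (x i s - z s - r i s) 0 k.
have dF (s : R) : 0 <= s -> is_derive s 1 F 0.
  move=> s0.
  have := is_derive_coord _ _ _ _ _ k (is_deriveB (is_deriveB (dx _ s0) (dz _ s0)) (dr _ s0)).
  move=> /is_derive_eq; apply.
  by rewrite addrK subrr mxE.
have := constant_of_is_derive0 _ _ dF _ t0.
by rewrite /F z0 subr0 xr0 subrr [RHS]mxE !mxE => /eqP; rewrite subr_eq0 => /eqP.
Qed.

(** With unit gains [fhat] is [x i + fp], and the coupling in the derivative of [x i] cancels that
    in the derivative of [fp]: [fhat] has derivative [e + y]. In the other two errors the coupling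
    cancels by subtraction or through the filter [z]. *)
Lemma observer_error_dynamics (k : 'I_m) (t : R) : 0 <= t ->
  [/\ is_derive t 1 (fun s => p s 0 k) (e t 0 k - p t 0 k),
      is_derive t 1 (fun s => e s 0 k) (df t 0 k - e t 0 k - y t 0 k) &
      is_derive t 1 (fun s => y s 0 k) (e t 0 k - y t 0 k)].
Proof.
have [_ [_ [dxh [drh dfp]]]] := obs.
move=> t0; split.
- have := is_derive_coord _ _ _ _ _ k (is_deriveB (dr _ t0) (drh _ t0)).
  move=> /is_derive_eq; apply.
  by rewrite reference_eq// /e /p !mxE; ring.
- have := is_derive_coord _ _ _ _ _ k
    (is_deriveB (df_f _ t0) (is_deriveD (is_deriveZ 1 (dx _ t0)) (dfp _ t0))).
  move=> /is_derive_eq; apply.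
  by rewrite /e /y !mxE; ring.
- have := is_derive_coord _ _ _ _ _ k (is_deriveB (dx _ t0) (dxh _ t0)).
  move=> /is_derive_eq; apply.
  by rewrite /e /y !mxE; ring.
Qed.

End observer_errors.

(** * Assembly of the coordinate estimates *)

Theorem theorem1 (R : realType) (n m : nat) (A : 'M[R]_n) (kappa : R)
  (r f x : 'I_n -> R -> 'rV[R]_m) (i : 'I_n) (df : R -> 'rV[R]_m) :
  adjacency_matrix A -> graph_connected A -> 0 < kappa ->
  (forall j (t : R), 0 <= t -> is_derive t 1 (r j) (f j t)) ->
  (forall j (t : R), 0 <= t -> is_derive t 1 (x j) (f j t + coupling kappa A x j t)) ->
  (forall j, x j 0 = r j 0) ->
  (forall t : R, 0 <= t -> is_derive t 1 (f i) (df t)) ->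
  (exists M : R, forall t : R, 0 <= t ->
     `|r i t| <= M /\ `|f i t| <= M /\ `|df t| <= M) ->
  exists k1 k2 k3 k4 : R,
    [/\ 0 < k1, 0 < k2, 0 < k3 & 0 < k4] /\
    (* (1) uniform ultimate boundedness of the estimation errors *)
    (exists b : R, forall xh rh fp z : R -> 'rV[R]_m,
        observer kappa A x i k1 k2 k3 k4 xh rh fp z ->
        exists T : R, forall t : R, T <= t ->
          `|r i t - rh t| <= b /\ `|f i t - fhat x i k3 fp t| <= b) /\
    (* (2) asymptotic convergence when df/dt is in L_2 *)
    (L2_vec df -> forall xh rh fp z : R -> 'rV[R]_m,
        observer kappa A x i k1 k2 k3 k4 xh rh fp z ->
        (r i t - rh t) @[t --> +oo] --> (0 : 'rV[R]_m) /\
        (f i t - fhat x i k3 fp t) @[t --> +oo] --> (0 : 'rV[R]_m)).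
Proof.
move=> _ _ _ dr dx xr0 df_f [M HM].
exists 1, 1, 1, 1; split; first by split.
have dfM (k : 'I_m) (t : R) : 0 <= t -> `|df t 0 k| <= M.
  by move=> t0; have [_ [_]] := HM _ t0; apply: le_trans; exact: coord_norm_le.
have dyn xh rh fp z (obs : observer kappa A x i 1 1 1 1 xh rh fp z) :=
  observer_error_dynamics R n m A kappa r f x i df (dr i) (dx i) (xr0 i) df_f
    xh rh fp z obs.
split.
(* The bound is chosen before the observer trajectory; initial values influence only the time
   [T]. *)
- exists (2 * `|M| + 1) => xh rh fp z /dyn {}dyn.
  have /choice[T TP] : forall k : 'I_m, exists T : R, forall t : R, T <= t ->
      `|(r i t - rh t) 0 k| <= 2 * `|M| + 1 /\
      `|(f i t - fhat x i 1 fp t) 0 k| <= 2 * `|M| + 1.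
    move=> k.
    apply: (@error_ultimate_bound R (fun t => (r i t - rh t) 0 k)
      (fun t => (f i t - fhat x i 1 fp t) 0 k) (fun t => (x i t - xh t) 0 k)
      (fun t => df t 0 k)).
    + by move=> t t0; have [] := dyn k t t0.
    + by move=> t t0; have [] := dyn k t t0.
    + by move=> t t0; have [] := dyn k t t0.
    + exact: dfM.
  have b0 : 0 <= 2 * `|M| + 1 by have := normr_ge0 M; lra.
  (* A single time that dominates every coordinate time [T k]. *)
  exists (\sum_k `|T k|) => t Tt.
  have Tk k : T k <= t.
    apply: le_trans Tt; apply: (le_trans (ler_norm _)).
    by rewrite (bigD1 k)//= lerDl sumr_ge0.
  by split; apply: rV_norm_le => // k; have [] := TP k t (Tk k).
- move=> L2 xh rh fp z /dyn {}dyn.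
  have cvg0 k : (r i t - rh t) 0 k @[t --> +oo] --> 0 /\
      (f i t - fhat x i 1 fp t) 0 k @[t --> +oo] --> 0.
    apply: (@error_cvg0 R (fun t => (r i t - rh t) 0 k)
      (fun t => (f i t - fhat x i 1 fp t) 0 k) (fun t => (x i t - xh t) 0 k)
      (fun t => df t 0 k) M).
    + by move=> t t0; have [] := dyn k t t0.
    + by move=> t t0; have [] := dyn k t t0.
    + by move=> t t0; have [] := dyn k t t0.
    + exact: dfM.
    + exact: L2_vec_coord.
  by split; apply: cvg_rV0 => k; have [] := cvg0 k.
Qed.
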